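(* Let $n\ge 1$ be an integer. Then the $(3,n)$-Turk's head link $TH(3,n)$ is amphichiral.
   Context: $TH(3,n)$ is the closure of the $3$-strand braid $(A_3)^n$, where $A_3=\sigma_1\sigma_2^{-1}$ and $\sigma_1,\sigma_2$ are the standard generators of the braid group on three strands. Two links in $\mathbb{R}^3$ are equivalent if an orientation-preserving homeomorphism of $\mathbb{R}^3$ maps one onto the other. The mirror image $L^*$ of a link $L$ is its image under reflection in a plane. $L$ is amphichiral if $L$ is equivalent to $L^*$. Links are considered without orientation. *)

(* Defs.v *)
From HB Require Import structures.
From mathcomp Require Import all_boot all_order all_algebra.
From mathcomp Require Import all_classical all_reals all_analysis.
From mathcomp Require Import freeg.

Set Implicit Arguments.
Unset Strict Implicit.
Unset Printing Implicit Defensive.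

Import Order.TTheory GRing.Theory Num.Theory.
Import numFieldNormedType.Exports.

Local Open Scope classical_set_scope.
Local Open Scope ring_scope.

(* Singular homology of subsets of R^3 is set up with normalised singular
   cubes: chains are taken modulo the degenerate cubes.  A continuous map on the
   cube [0,1]^n is encoded by its composition with the retraction
   [cube_retract] of R^n onto [0,1]^n, so that Leibniz equality of encodings is
   equality of maps on the cube. *)

Section CubicalChains.
Variable R : realType.

Definition cube_retract (n : nat) (t : 'rV[R]_n) : 'rV[R]_n :=
  \row_j Num.max 0 (Num.min 1 (t 0 j)).

Definition cubeMap (n : nat) : Type := {classic ('rV[R]_n -> 'rV[R]_3)}.

Definition singular_cube (A : set 'rV[R]_3) (n : nat) (f : cubeMap n) : Prop :=
  [/\ continuous (f : 'rV[R]_n -> 'rV[R]_3),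
      forall t, f (cube_retract t) = f t
    & forall t, A (f t)].

Definition degenerate_cube (n : nat) (f : cubeMap n) : Prop :=
  exists i : 'I_n, forall s t : 'rV[R]_n,
    (forall j, j != i -> s 0 j = t 0 j) -> f s = f t.

Definition chain (n : nat) : Type := {freeg (cubeMap n)}.

(* [chain_in A c] : all cubes occurring in [c] lie in [A]. *)
Definition chain_in (A : set 'rV[R]_3) (n : nat) (c : chain n) : Prop :=
  forall f, f \in dom c -> singular_cube A f.

Definition degenerate_chain (n : nat) (c : chain n) : Prop :=
  forall f, f \in dom c -> singular_cube setT f /\ degenerate_cube f.

(* The inclusion of the face t_i = b of the cube. *)
Definition face_incl (n : nat) (i : 'I_n.+1) (b : bool) (t : 'rV[R]_n) :
    'rV[R]_n.+1 :=
  \row_j (if unlift i j is Some k then t 0 k else b%:R).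

Definition cube_boundary (n : nat) (f : cubeMap n.+1) : chain n :=
  \sum_(i < n.+1) (-1) ^+ i *:
    (<< (f \o face_incl i true : cubeMap n) >>
     - << (f \o face_incl i false : cubeMap n) >>).

Definition boundary (n : nat) (c : chain n.+1) : chain n :=
  fglift (@cube_boundary n) c.

Definition push (h : 'rV[R]_3 -> 'rV[R]_3) (n : nat) (c : chain n) : chain n :=
  fglift (fun f : cubeMap n => << (h \o f : cubeMap n) >> : chain n) c.

(* Cycles of the pair (R^3, A). *)
Definition rel_cycle (A : set 'rV[R]_3) (n : nat) (c : chain n.+1) : Prop :=
  chain_in setT c /\
  exists a d : chain n,
    [/\ chain_in A a, degenerate_chain d & boundary c = a + d].

(* [c] and [c'] define the same class in the homology of the pair (R^3, A). *)
Definition rel_homologous (A : set 'rV[R]_3) (n : nat) (c c' : chain n) : Prop :=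
  exists (e : chain n.+1) (a d : chain n),
    [/\ chain_in setT e, chain_in A a, degenerate_chain d
      & c - c' = boundary e + a + d].

End CubicalChains.

Section Links.
Variable R : realType.

Definition homeomorphism (h : 'rV[R]_3 -> 'rV[R]_3) : Prop :=
  continuous h /\
  exists g : 'rV[R]_3 -> 'rV[R]_3, [/\ continuous g, cancel h g & cancel g h].

(* [h] carries the standard local orientation at each point [p] to the one at
   [h p].  The standard orientation of R^3 is the translation-invariant family
   of generators of H_3(R^3, R^3 - p), which is infinite cyclic; so the condition
   is that [h] and the translation taking [p] to [h p] induce the same map
   H_3(R^3, R^3 - p) -> H_3(R^3, R^3 - h p). *)
Definition orientation_preserving (h : 'rV[R]_3 -> 'rV[R]_3) : Prop :=
  forall (p : 'rV[R]_3) (c : chain R 3),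
    rel_cycle (~` [set p]) c ->
    rel_homologous (~` [set h p]) (push h c) (push (fun x => x + (h p - p)) c).

(* A link is given by its underlying (unoriented) point set. *)
Definition link_equiv (L L' : set 'rV[R]_3) : Prop :=
  exists h : 'rV[R]_3 -> 'rV[R]_3,
    [/\ homeomorphism h, orientation_preserving h & h @` L = L'].

Definition dotv (u v : 'rV[R]_3) : R := (u *m v^T) 0 0.

(* The reflection in the plane { x | <u, x> = a }, for u != 0. *)
Definition reflection (u : 'rV[R]_3) (a : R) (x : 'rV[R]_3) : 'rV[R]_3 :=
  x - (2 * (dotv u x - a) / dotv u u) *: u.

(* The plane of reflection is arbitrary. *)
Definition amphichiral (L : set 'rV[R]_3) : Prop :=
  forall (u : 'rV[R]_3) (a : R), u != 0 -> link_equiv L (reflection u a @` L).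

(* A geometric braid is the union of its strands, a set of points ((x, y), t)
   with (x, y) in the plane and t in [0,1]; an m-strand braid has its endpoints
   over the points (1, 0), ..., (m, 0). *)
Definition geometric_braid : Type := set ((R * R) * R).

(* The generator sigma_i (1 <= i < m) of the m-strand braid group: strands i
   and i+1 exchange places by a counterclockwise half turn about their
   midpoint. *)
Definition sigma (m i : nat) : geometric_braid :=
  [set q | let: ((x, y), t) := q in
    0 <= t <= 1 /\
    [\/ exists j : nat,
          [/\ (1 <= j <= m)%N, j != i, j != i.+1 & (x, y) = (j%:R, 0)],
        (x, y) = (i%:R + 2^-1 - 2^-1 * cos (pi * t), - (2^-1 * sin (pi * t)))
      | (x, y) = (i%:R + 2^-1 + 2^-1 * cos (pi * t), 2^-1 * sin (pi * t))]].

Definition braid_inv (B : geometric_braid) : geometric_braid :=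
  [set q | B (q.1, 1 - q.2)].

(* The product of a nonempty sequence of braids: they are stacked in slabs
   of equal height. *)
Definition braid_prod (s : seq geometric_braid) : geometric_braid :=
  [set q | exists2 k, (k < size s)%N &
    nth set0 s k (q.1, (size s)%:R * q.2 - k%:R)].

(* The closure about the third coordinate axis: the half-plane with polar angle
   2 pi t contains the slice of the braid at height t. *)
Definition braid_closure (B : geometric_braid) : set 'rV[R]_3 :=
  [set v | exists x y t : R, B ((x, y), t) /\
    v = \row_(i < 3) [:: x * cos (2 * pi * t); x * sin (2 * pi * t); y]`_i].

Definition braid_A3 : geometric_braid :=
  braid_prod [:: sigma 3 1; braid_inv (sigma 3 2)].

Definition turks_head3 (n : nat) : set 'rV[R]_3 :=
  braid_closure (braid_prod (nseq n braid_A3)).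

End Links.

(* Main.v *)
From HB Require Import structures.
Require Import Defs.
From mathcomp Require Import freeg.
From mathcomp Require Import all_boot all_order all_algebra.
From mathcomp Require Import all_classical all_reals all_analysis.
From mathcomp Require Import ring lra.

Set Implicit Arguments.
Unset Strict Implicit.
Unset Printing Implicit Defensive.

Import Order.TTheory GRing.Theory Num.Theory.
Import numFieldNormedType.Exports.

Local Open Scope classical_set_scope.
Local Open Scope ring_scope.

(** The Turk's head link lives in a tubular neighbourhood of the round circle
    of radius 2 about the third axis, the core.  Write a point of that
    neighbourhood as (x, y, tau), where x is the distance to the axis, y the
    height and pi * tau / n the polar angle.  The braid word is
    (sigma_1 sigma_2^-1)^n, and the reflection x |-> 4 - x of the meridian disc
    turns sigma_1 into sigma_2^-1 and conversely; so the link is invariant under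
    the orientation-reversing screw (x, y, tau) |-> (4 - x, y, tau + 1), which
    moves each crossing to the next one ([slab_flip]).

    This screw is, on the neighbourhood, the composite of three maps: the half
    turn (x, y) |-> (4 - x, - y) of every meridian disc, the rotation by pi / n
    about the axis, and the reflection in the horizontal plane.  The half turn
    extends to R^3 as a twist that dies out before it reaches the axis; it and
    the rotation are ends of ambient isotopies.  Hence an ambient isotopy
    carries the link to its mirror image in the horizontal plane
    ([turks_head3_mirror]).  The mirror image in any other plane is reached by
    moving the plane: if u_s is a path of nonzero vectors from u to w, then
    composing the reflections along u and along u_s is an isotopy
    ([isotopic_reflections]).

    It remains to see that the end h of an ambient isotopy preserves
    orientation in the homological sense.  If H is the isotopy, the maps
    x |-> H_s x - H_s p + h p form a homotopy, through maps that send p and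
    only p to h p, from the translation taking p to h p to the map h itself.
    Homotopy invariance of relative homology then gives the claim; for cubical
    chains the prism over a cube is again a cube, and the proof is the usual
    prism formula ([homotopy_formula], [homotopy_invariance]). *)

(** * Additive maps on free abelian groups *)

Section FreeGroup.
Variable K : choiceType.

HB.instance Definition _ (M : lmodType int) (f : K -> M) :=
  GRing.isZmodMorphism.Build {freeg K} M (fglift f) (lift_is_additive f).

Lemma additive_freeg_ext (M : zmodType) (f g : {additive {freeg K} -> M}) :
  (forall z, f << z >> = g << z >>) -> f =1 g.
Proof.
move=> fg D; rewrite -(freeg_sumE D) !raddf_sum; apply: eq_bigr => z _.
by rewrite -[coeff z D]intz -freegU_mulz !raddfMz fg.
Qed.

Lemma dom_fglift (K' : choiceType) (F : K -> {freeg K'}) (D : {freeg K})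
    (z' : K') :
  z' \in dom (fglift F D) -> exists2 z, z \in dom D & z' \in dom (F z).
Proof.
rewrite -{1}(freeg_sumE D) raddf_sum => /dom_sum_subset.
move=> /flattenP[s /mapP[z]]; rewrite filter_predT => zD -> /=.
by rewrite liftU => /domZ_subset; exists z.
Qed.
End FreeGroup.

(** * Homotopy invariance of cubical homology *)

Section Prism.
Variable R : realType.
Local Notation V := 'rV[R]_3.

HB.instance Definition _ n :=
  GRing.Additive.copy (@boundary R n) (fglift (@cube_boundary R n)).
HB.instance Definition _ (h : V -> V) n := GRing.Additive.copy (@push R h n)
  (fglift (fun f : cubeMap R n => << (h \o f : cubeMap R n) >> : chain R n)).

(** The retraction of the line onto the unit interval: the time coordinate of a
    prism has to factor through it, as cubes are encoded by their composition
    with the retraction onto the standard cube. *)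
Definition clamp (s : R) : R := Num.max 0 (Num.min 1 s).

Definition tail n (t : 'rV[R]_n.+1) : 'rV[R]_n := \row_j t 0 (lift ord0 j).

Definition prism (G : R -> V -> V) n (f : cubeMap R n) : cubeMap R n.+1 :=
  fun t => G (clamp (t 0 0)) (f (tail t)).

Definition prism_chain (G : R -> V -> V) n (c : chain R n) : chain R n.+1 :=
  fglift (fun f => << prism G f >> : chain R n.+1) c.

HB.instance Definition _ G n := GRing.Additive.copy (@prism_chain G n)
  (fglift (fun f : cubeMap R n => << prism G f >> : chain R n.+1)).

Lemma boundaryU n (f : cubeMap R n.+1) : boundary << f >> = cube_boundary f.
Proof. by rewrite /boundary liftU scale1r. Qed.
Lemma pushU h n (f : cubeMap R n) :
  push h << f >> = << (h \o f : cubeMap R n) >> :> chain R n.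
Proof. by rewrite /push liftU scale1r. Qed.
Lemma prism_chainU G n (f : cubeMap R n) :
  prism_chain G << f >> = << prism G f >>.
Proof. by rewrite /prism_chain liftU scale1r. Qed.

Lemma clamp0 : clamp 0 = 0.
Proof. by rewrite /clamp min_r ?ler01// maxxx. Qed.
Lemma clamp1 : clamp 1 = 1.
Proof. by rewrite /clamp minxx max_r ?ler01. Qed.

Lemma prism_end G n (f : cubeMap R n) b :
  (prism G f \o face_incl ord0 b) = (G b%:R \o f).
Proof.
apply/funext => t; rewrite /prism /= mxE unlift_none.
congr (G _ (f _)); first by case: b; rewrite ?clamp0 ?clamp1.
by apply/rowP => j; rewrite !mxE liftK.
Qed.

(** The faces of the prism other than its two ends are prisms over the faces;
    the shift of the index by one is what makes the prism anticommute with the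
    boundary. *)
Lemma prism_side G n (f : cubeMap R n.+1) (i : 'I_n.+1) b :
  (prism G f \o face_incl (lift ord0 i) b) = prism G (f \o face_incl i b).
Proof.
apply/funext => t; rewrite /prism /= mxE.
have -> : unlift (lift ord0 i) ord0 = Some (@ord0 n).
  rewrite -[RHS](liftK (lift ord0 i)); congr (unlift _ _).
  exact: val_inj.
congr (G _ (f _)).
apply/rowP => j; rewrite !mxE; case: (unliftP i j) => [k ->|->].
  have -> : lift (@ord0 n.+1) (lift i k) = lift (lift ord0 i) (lift ord0 k).
    by apply: val_inj; rewrite /= /bump /= !add1n ltnS addnS.
  by rewrite !liftK mxE.
by rewrite !unlift_none.
Qed.

(** Both sides are additive, so it is enough to compare them on a single cube,
    where the summand of index 0 on the left gives the two ends. *)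
Lemma homotopy_formula G n (c : chain R n.+1) :
  boundary (prism_chain G c) =
  push (G 1) c - push (G 0) c - prism_chain G (boundary c).
Proof.
pose lhs : {additive {freeg cubeMap R n.+1} -> chain R n.+1} :=
  @boundary R n.+1 \o @prism_chain G n.+1.
pose rhs : {additive {freeg cubeMap R n.+1} -> chain R n.+1} :=
  (@push R (G 1) n.+1 \- @push R (G 0) n.+1) \-
  (@prism_chain G n \o @boundary R n).
apply: (@additive_freeg_ext _ _ lhs rhs) => f /=.
rewrite prism_chainU !boundaryU !pushU /cube_boundary big_ord_recl.
rewrite expr0 scale1r.
rewrite !prism_end; congr (_ + _).
rewrite raddf_sum /= -sumrN; apply: eq_bigr => i _.
rewrite !prism_side exprS mulN1r scaleNr; congr (- _).
set u := << f \o face_incl i true >>; set v := << f \o face_incl i false >>.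
have -> : prism_chain G ((-1) ^+ i *: (u - v)) =
          (-1) ^+ i *: prism_chain G (u - v).
  by rewrite -signr_odd; case: (odd i); rewrite ?expr1 ?expr0 ?scaleN1r
    ?scale1r // raddfN.
by rewrite [prism_chain _ _]raddfB /= !prism_chainU.
Qed.

Lemma continuous_row (T : topologicalType) m (F : T -> 'rV[R]_m) :
  (forall j, continuous (fun x => F x 0 j)) -> continuous F.
Proof.
move=> cF x; apply/cvg_ballP => e e0.
have : forall j : 'I_m, \forall y \near x, ball (F x 0 j) e (F y 0 j).
  by move=> j; by have /cvg_ballP := cF j x; exact.
move=> /filter_forall; apply: filterS => y h; split => // i j.
by rewrite (ord1 i).
Qed.

Lemma continuous_substitute (T U W Z : topologicalType) (G : U -> W -> Z)
    (f : T -> U) (g : T -> W) :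
    continuous (fun z : U * W => G z.1 z.2) -> continuous f -> continuous g ->
  continuous (fun x => G (f x) (g x)).
Proof.
move=> cG cf cg x; apply: (@continuous2_cvg _ _ _ _ (nbhs x) _ f g G).
- exact: (cG (f x, g x)).
- exact: cf.
- exact: cg.
Qed.

Lemma continuous_clamp : continuous clamp.
Proof.
move=> x; apply: continuous_max; first exact: cvg_cst.
by apply: continuous_min; [exact: cvg_cst|exact: cvg_id].
Qed.

Lemma continuous_tail n : continuous (@tail n).
Proof.
apply: continuous_row => j x.
rewrite (_ : (fun _ => _) = fun t : 'rV[R]_n.+1 => t 0 (lift ord0 j)).
  exact: coord_continuous.
by apply/funext => t; rewrite mxE.
Qed.

Lemma clampK s : clamp (clamp s) = clamp s.
Proof.
rewrite /clamp; case: (leP 1 s) => s1.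
  by rewrite (max_r ler01) minxx (max_r ler01).
case: (leP 0 s) => s0; last by rewrite (min_r ler01) maxxx.
by rewrite (min_r (ltW s1)) (max_r s0).
Qed.

Lemma tail_retract n (t : 'rV[R]_n.+1) :
  tail (cube_retract t) = cube_retract (tail t).
Proof. by apply/rowP => j; rewrite !mxE. Qed.

Lemma singular_prism (A B : set V) G n (f : cubeMap R n) :
    continuous (fun sx : R * V => G sx.1 sx.2) ->
    (forall s x, A x -> B (G s x)) ->
  singular_cube A f -> singular_cube B (prism G f).
Proof.
move=> cG AB [cf rf Af]; split; rewrite /prism.
- apply: (continuous_substitute cG) => t.
  + apply: continuous_comp; first exact: coord_continuous.
    exact: continuous_clamp.
  + by apply: continuous_comp; [exact: continuous_tail|exact: cf].
- by move=> t; rewrite tail_retract rf mxE -/(clamp _) clampK.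
- by move=> t; apply: AB; exact: Af.
Qed.

(** A prism over a degenerate cube is constant along the same direction; this
    is why the prism operator descends to normalised chains. *)
Lemma degenerate_prism G n (f : cubeMap R n) :
  degenerate_cube f -> degenerate_cube (prism G f).
Proof.
move=> [i fi]; exists (lift ord0 i) => s t st; rewrite /prism st //.
congr (G _ _); apply: fi => j ji; rewrite !mxE; apply: st.
by rewrite (inj_eq lift_inj).
Qed.

Lemma chain_in_prism (A B : set V) G n (c : chain R n) :
    continuous (fun sx : R * V => G sx.1 sx.2) ->
    (forall s x, A x -> B (G s x)) ->
  chain_in A c -> chain_in B (prism_chain G c).
Proof.
move=> cG AB Ac f /dom_fglift[g gc]; rewrite domU1 inE => /eqP ->.
exact: singular_prism cG AB (Ac _ gc).
Qed.

Lemma degenerate_chain_prism G n (c : chain R n) :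
    continuous (fun sx : R * V => G sx.1 sx.2) ->
  degenerate_chain c -> degenerate_chain (prism_chain G c).
Proof.
move=> cG dc f /dom_fglift[g /dc[sg dg]]; rewrite domU1 inE => /eqP ->.
by split; [exact: singular_prism cG _ sg|exact: degenerate_prism].
Qed.

(** The prism over the boundary of a cycle of the pair lies in [B], up to degenerate
    chains, so the prism formula exhibits the required relation. *)
Lemma homotopy_invariance (A B : set V) G n (c : chain R n.+1) :
    continuous (fun sx : R * V => G sx.1 sx.2) ->
    (forall s x, A x -> B (G s x)) ->
  rel_cycle A c -> rel_homologous B (push (G 1) c) (push (G 0) c).
Proof.
move=> cG AB [cT [a [d [aA dd cad]]]].
exists (prism_chain G c), (prism_chain G a), (prism_chain G d); split.
- exact: chain_in_prism cG _ cT.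
- exact: chain_in_prism cG AB aA.
- exact: degenerate_chain_prism.
- by rewrite homotopy_formula cad raddfD /= -addrA subrK.
Qed.
End Prism.

(** * Continuity of real-valued expressions *)

Section RealContinuity.
Context {R : realType} {T : topologicalType}.
Implicit Types f g : T -> R.

Lemma ctsD f g :
  continuous f -> continuous g -> continuous (fun x => f x + g x).
Proof. by move=> cf cg x; apply: cvgD; [exact: cf|exact: cg]. Qed.
Lemma ctsN f : continuous f -> continuous (fun x => - f x).
Proof. by move=> cf x; exact: (@continuousN R R^o T f x (cf x)). Qed.
Lemma ctsM f g :
  continuous f -> continuous g -> continuous (fun x => f x * g x).
Proof. by move=> cf cg x; apply: cvgM; [exact: cf|exact: cg]. Qed.
Lemma ctsV f :
  (forall x, f x != 0) -> continuous f -> continuous (fun x => (f x)^-1).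
Proof. by move=> f0 cf x; apply: cvgV; [exact: f0|exact: cf]. Qed.
Lemma cts_cst (a : R) : continuous (fun _ : T => a).
Proof. by move=> x; exact: cvg_cst. Qed.
Lemma cts_comp (U W : topologicalType) (f : U -> W) (g : T -> U) :
  continuous f -> continuous g -> continuous (fun x => f (g x)).
Proof.
by move=> cf cg x; exact: (@continuous_comp T U W g f x (cg x) (cf _)).
Qed.
Lemma cts_coord m (F : T -> 'rV[R]_m) j :
  continuous F -> continuous (fun x => F x 0 j).
Proof. by move=> cF; exact: (cts_comp (@coord_continuous R 1 m 0 j) cF). Qed.
End RealContinuity.

(** * Ambient isotopies *)

Section Isotopies.
Variable R : realType.
Local Notation V := 'rV[R]_3.
Implicit Types (L : set V) (H K : R -> V -> V).

(** [K s] is the inverse of [H s]; carrying it along makes the joint continuity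
    of the inverses part of the data and so makes every stage a homeomorphism. *)
Definition isotopy H K : Prop :=
  [/\ continuous (fun z : R * V => H z.1 z.2),
      continuous (fun z : R * V => K z.1 z.2),
      forall s, cancel (H s) (K s), forall s, cancel (K s) (H s)
    & forall x, H 0 x = x].

Definition isotopic L L' : Prop :=
  exists H K, isotopy H K /\ H 1 @` L = L'.

Lemma isotopic_trans L1 L2 L3 :
  isotopic L1 L2 -> isotopic L2 L3 -> isotopic L1 L3.
Proof.
move=> [H [K [[cH cK HK KH H0] <-]]] [H' [K' [[cH' cK' HK' KH' H0'] <-]]].
exists (fun s x => H' s (H s x)), (fun s x => K s (K' s x)); split.
  split.
  - exact: (continuous_substitute cH' (fun=> cvg_fst) cH).
  - exact: (continuous_substitute cK (fun=> cvg_fst) cK').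
  - by move=> s x; rewrite HK' HK.
  - by move=> s x; rewrite KH KH'.
  - by move=> x; rewrite H0 H0'.
by rewrite image_comp.
Qed.

Lemma isotopy_continuous H K s : isotopy H K -> continuous (H s).
Proof.
move=> [cH _ _ _ _].
exact: (continuous_substitute cH (fun=> cvg_cst _) (fun=> cvg_id)).
Qed.

(** Recentring each stage so that it sends [p] to [H 1 p] turns the isotopy into
    a homotopy of maps of pairs from a translation to [H 1]; injectivity of the
    stages keeps the complement of [p] in the complement of [H 1 p]. *)
Lemma isotopy_orientation_preserving H K :
  isotopy H K -> orientation_preserving (H 1).
Proof.
move=> [cH _ HK _ H0] p c cc.
pose G s x := H s x - H s p + H 1 p.
have cG : continuous (fun z : R * V => G z.1 z.2).
  have cHp : continuous (fun z : R * V => H z.1 p).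
    exact: (continuous_substitute cH (fun=> cvg_fst) (fun=> cvg_cst _)).
  move=> z; apply: cvgD; last exact: cvg_cst.
  by apply: cvgB; [exact: cH|exact: cHp].
have Gp s x : (~` [set p]) x -> (~` [set H 1 p]) (G s x).
  move=> xp /= /(canRL (addrK _)); rewrite subrr => /eqP.
  by rewrite subr_eq0 => /eqP /(can_inj (HK s)).
have -> : H 1 = G 1 by apply/funext => x; rewrite /G subrK.
have -> : (fun x => x + (G 1 p - p)) = G 0.
  by apply/funext => x; rewrite /G !H0 subrr add0r addrA addrAC.
have -> : G 1 p = H 1 p by rewrite /G subrr add0r.
exact: (homotopy_invariance cG Gp cc).
Qed.

Lemma isotopic_link_equiv L L' : isotopic L L' -> link_equiv L L'.
Proof.
move=> [H [K [HK HL]]]; exists (H 1); split => //.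
- split; first exact: isotopy_continuous HK.
  case: HK => _ cK HK KH _; exists (K 1); split => //.
  exact: (continuous_substitute cK (fun=> cvg_cst _) (fun=> cvg_id)).
- exact: isotopy_orientation_preserving HK.
Qed.

(** * Isotopies between reflections *)

Lemma dotvE (u v : V) : dotv u v = \sum_i u 0 i * v 0 i.
Proof. by rewrite /dotv mxE; apply: eq_bigr => i _; rewrite mxE. Qed.

Lemma dotvC (u v : V) : dotv u v = dotv v u.
Proof. by rewrite !dotvE; apply: eq_bigr => i _; rewrite mulrC. Qed.

Lemma dotvDr (u v w : V) : dotv u (v + w) = dotv u v + dotv u w.
Proof. by rewrite /dotv linearD /= mulmxDr mxE. Qed.

Lemma dotvZr a (u v : V) : dotv u (a *: v) = a * dotv u v.
Proof. by rewrite /dotv linearZ /= -scalemxAr mxE. Qed.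

Lemma dotvv_ge0 (u : V) : 0 <= dotv u u.
Proof. by rewrite dotvE sumr_ge0 // => i _; rewrite -expr2 sqr_ge0. Qed.

Lemma dotvv_gt0 (u : V) : (0 < dotv u u) = (u != 0).
Proof.
rewrite lt0r dotvv_ge0 andbT; congr (~~ _); apply/eqP/eqP => [|->]; last first.
  by rewrite dotvE big1 // => i _; rewrite mxE mul0r.
rewrite dotvE => /eqP; rewrite psumr_eq0 => [/allP u0|i _]; last first.
  by rewrite -expr2 sqr_ge0.
apply/rowP => i; have := u0 i (mem_index_enum i).
by rewrite mulf_eq0 orbb mxE => /eqP.
Qed.

Lemma reflectionK (u : V) a : u != 0 -> involutive (reflection u a).
Proof.
rewrite -dotvv_gt0 => /lt0r_neq0 u0 x; rewrite /reflection.
set k := 2 * _ / _; rewrite -[in dotv u _]scaleNr dotvDr dotvZr.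
rewrite -addrA -opprD -scalerDl [X in X *: u](_ : _ = 0) ?scale0r ?subr0 //.
by rewrite /k; field.
Qed.

Lemma reflectionN (u : V) a : reflection (- u) (- a) = reflection u a.
Proof.
have dN (x : V) : dotv (- u) x = - dotv u x.
  by rewrite dotvC -scaleN1r dotvZr dotvC mulN1r.
apply/funext => x; rewrite /reflection scalerN -scaleNr; congr (x - _ *: u).
by rewrite (dN x) (dN (- u)) (dotvC u (- u)) (dN u) !opprK; ring.
Qed.

Lemma continuous_dotv (T : topologicalType) (f g : T -> V) :
  continuous f -> continuous g -> continuous (fun x => dotv (f x) (g x)).
Proof.
move=> cf cg; rewrite (_ : (fun _ => _) = (fun x => f x 0 0 * g x 0 0 +
  (f x 0 (lift ord0 ord0) * g x 0 (lift ord0 ord0) +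
   f x 0 (lift ord0 (lift ord0 ord0)) * g x 0 (lift ord0 (lift ord0 ord0))))).
  by do ?[apply: ctsD | apply: ctsM | apply: cts_coord].
by apply/funext => x; rewrite dotvE !big_ord_recl big_ord0 addr0.
Qed.

Lemma continuous_reflection (T : topologicalType) (u : T -> V) (a : T -> R)
    (f : T -> V) :
    (forall x, u x != 0) -> continuous u -> continuous a -> continuous f ->
  continuous (fun x => reflection (u x) (a x) (f x)).
Proof.
move=> u0 cu ca cf; apply: continuous_row => j.
rewrite (_ : (fun _ => _) = (fun x => f x 0 j -
  (2 * (dotv (u x) (f x) - a x) / dotv (u x) (u x)) * u x 0 j)); last first.
  by apply/funext => x; rewrite /reflection !mxE.
apply: ctsD; first exact: cts_coord.
apply: ctsN; apply: ctsM; last exact: cts_coord.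
apply: ctsM; first apply: ctsM; first exact: cts_cst.
  by apply: ctsD; [exact: continuous_dotv|exact: ctsN].
apply: ctsV; last exact: continuous_dotv.
by move=> x; rewrite lt0r_neq0 // dotvv_gt0.
Qed.

(** When [u] and [w] do not make an obtuse angle, the segment between them avoids
    0, so the plane can be moved along it.  The first reflection is undone by
    [reflection u a] and redone along the moving vector. *)
Lemma isotopic_reflections_acute (u w : V) (a b : R) L :
    u != 0 -> w != 0 -> 0 <= dotv u w ->
  isotopic (reflection u a @` L) (reflection w b @` L).
Proof.
move=> u0 w0 uw.
pose v s := (1 - clamp s) *: u + clamp s *: w.
pose c s := (1 - clamp s) * a + clamp s * b.
have v0 s : v s != 0.
  have := dotvv_gt0 u; have := dotvv_gt0 w; rewrite u0 w0 -dotvv_gt0 => ww uu.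
  have : 0 <= clamp s <= 1.
    by rewrite /clamp le_max lexx ge_max ler01 ge_min lexx.
  rewrite /v; move: (clamp s) => r /andP[r0 r1].
  rewrite dotvDr !dotvZr !(dotvC (_ + _)) !dotvDr !dotvZr (dotvC w u).
  (* For r < 1 the coefficient of dotv u u is positive and no term is negative;
     r = 1 has to be treated apart. *)
  have [r1'|r1'] := ltP r 1; last first.
    by have -> : r = 1 by [lra]; rewrite subrr !mul0r !mul1r !add0r.
  have h1 : 0 < (1 - r) ^+ 2 * dotv u u.
    by rewrite mulr_gt0 // exprn_gt0 // subr_gt0.
  have h2 : 0 <= r * (1 - r) * dotv u w by rewrite !mulr_ge0 // subr_ge0.
  have h3 : 0 <= r ^+ 2 * dotv w w by rewrite mulr_ge0 ?sqr_ge0 // ltW.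
  by rewrite !expr2 in h1 h2 h3 *; lra.
have cclamp : continuous (fun z : R * V => clamp z.1).
  exact: (cts_comp (@continuous_clamp R) (fun=> cvg_fst)).
have cv : continuous (fun z : R * V => v z.1).
  apply: continuous_row => j.
  rewrite (_ : (fun _ => _) =
      (fun z => (1 - clamp z.1) * u 0 j + clamp z.1 * w 0 j)).
    by do ?[exact: cclamp | exact: cts_cst
           | apply: ctsD | apply: ctsM | apply: ctsN].
  by apply/funext => z; rewrite !mxE.
have cc : continuous (fun z : R * V => c z.1).
  by do ?[exact: cclamp | exact: cts_cst
         | apply: ctsD | apply: ctsM | apply: ctsN].
exists (fun s x => reflection (v s) (c s) (reflection u a x)),
  (fun s x => reflection u a (reflection (v s) (c s) x)); split.
  split.
  - apply: continuous_reflection => //.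
    apply: continuous_reflection => //; do ?exact: cts_cst;
      by move=> ?; exact: cvg_cst || exact: cvg_snd.
  - apply: continuous_reflection => //; do ?exact: cts_cst.
      by move=> ?; exact: cvg_cst.
    by apply: continuous_reflection => // ?; exact: cvg_snd.
  - by move=> s x; rewrite !reflectionK.
  - by move=> s x; rewrite !reflectionK.
  - move=> x; rewrite /v /c clamp0 subr0 !scale1r !scale0r !mul1r mul0r !addr0.
    by rewrite reflectionK.
rewrite image_comp; congr (_ @` _); apply/funext => x /=.
rewrite reflectionK // /v /c clamp1 subrr !scale1r !scale0r !mul1r mul0r.
by rewrite !add0r.
Qed.

(** The vectors [w] and [- w] define the same planes, so an obtuse angle can be
    avoided. *)
Lemma isotopic_reflections (u w : V) (a b : R) L : u != 0 -> w != 0 ->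
  isotopic (reflection u a @` L) (reflection w b @` L).
Proof.
move=> u0 w0; case: (leP 0 (dotv u w)) => uw.
  exact: isotopic_reflections_acute.
rewrite -(reflectionN w); apply: isotopic_reflections_acute.
- by [].
- by rewrite oppr_eq0.
- by rewrite -scaleN1r dotvZr; lra.
Qed.
End Isotopies.

(** * The twist about the core and the rotations about the axis *)

Section Twist.
Variable R : realType.
Local Notation V := 'rV[R]_3.

Definition vec3 (a b c : R) : V := \row_(i < 3) [:: a; b; c]`_i.

Lemma vec3_0 a b c : vec3 a b c 0 0 = a. Proof. by rewrite mxE. Qed.
Lemma vec3_1 a b c : vec3 a b c 0 1 = b. Proof. by rewrite mxE. Qed.
Lemma vec3_2 a b c : vec3 a b c 0 2 = c. Proof. by rewrite mxE. Qed.
Definition vec3E := (vec3_0, vec3_1, vec3_2).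

Lemma vec3_surj (v : V) : v = vec3 (v 0 0) (v 0 1) (v 0 2).
Proof.
apply/rowP => -[[|[|[|//]]] p]; rewrite mxE /=; congr (v 0 _); exact: val_inj.
Qed.

Lemma continuous_vec3 (T : topologicalType) (f g h : T -> R) :
  continuous f -> continuous g -> continuous h ->
  continuous (fun x => vec3 (f x) (g x) (h x)).
Proof.
move=> cf cg ch; apply: continuous_row => -[[|[|[|//]]] p].
- by under eq_fun do rewrite mxE /=.
- by under eq_fun do rewrite mxE /=.
- by under eq_fun do rewrite mxE /=.
Qed.

Definition radius (v : V) : R := Num.sqrt (v 0 0 ^+ 2 + v 0 1 ^+ 2).

(** The squared distance to the core, the circle of radius 2 in the horizontal
    plane. *)
Definition core_dist2 (v : V) : R := (radius v - 2) ^+ 2 + v 0 2 ^+ 2.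

(** At [s = 1] the angle is pi within distance 1 of the core, where the link lies,
    and it vanishes from distance sqrt 2 on, in particular near the axis. *)
Definition twist_angle (s : R) (v : V) : R :=
  s * (pi * clamp (2 - core_dist2 v)).

(** In every half-plane through the axis, [twist s] rotates about the core by
    [twist_angle s].  The factor [k] is the ratio of the new radius to the old
    one.  Replacing the denominator by its maximum with 1/2 changes nothing where
    the angle is nonzero, and makes the formula continuous across the axis. *)
Definition twist (s : R) (v : V) : V :=
  let a := twist_angle s v in
  let k := 1 + ((radius v - 2) * (cos a - 1) - v 0 2 * sin a) /
               Num.max (radius v) 2^-1 in
  vec3 (v 0 0 * k) (v 0 1 * k) ((radius v - 2) * sin a + v 0 2 * cos a).

Lemma continuous_twist : continuous (fun z : R * V => twist z.1 z.2).
Proof.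
have c2 j : continuous (fun z : R * V => z.2 0 j).
  by apply: cts_coord => ?; exact: cvg_snd.
have c1 : continuous (fun z : R * V => z.1) by move=> ?; exact: cvg_fst.
have cr : continuous (fun z : R * V => radius z.2).
  apply: (cts_comp (@sqrt_continuous R)).
  by apply: ctsD; apply: ctsM; exact: c2.
have cq : continuous (fun z : R * V => core_dist2 z.2).
  by do ![exact: cr | exact: c2 | exact: cts_cst | apply: ctsD | apply: ctsM].
have ca : continuous (fun z : R * V => twist_angle z.1 z.2).
  apply: ctsM => //; apply: ctsM; first exact: cts_cst.
  apply: (cts_comp (@continuous_clamp R)).
  by apply: ctsD; [exact: cts_cst | exact: ctsN].
have cc : continuous (fun z : R * V => cos (twist_angle z.1 z.2)).
  exact: (cts_comp (@continuous_cos R)).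
have cs : continuous (fun z : R * V => sin (twist_angle z.1 z.2)).
  exact: (cts_comp (@continuous_sin R)).
have cm : continuous (fun z : R * V => (Num.max (radius z.2) 2^-1)^-1).
  apply: ctsV.
    by move=> z; rewrite lt0r_neq0 // lt_max invr_gt0 ltr0n orbT.
  move=> z; exact: (@continuous_max R (R * V)%type (fun z => radius z.2)
    (fun=> 2^-1) z (cr z) (cvg_cst _)).
by apply: continuous_vec3; do ![exact: cr | exact: cc | exact: cs | exact: cm
  | exact: c2 | exact: cts_cst | apply: ctsD | apply: ctsM | apply: ctsN].
Qed.

Lemma radius_polar r c d y :
  0 <= r -> c ^+ 2 + d ^+ 2 = 1 -> radius (vec3 (r * c) (r * d) y) = r.
Proof.
move=> r0 cd; rewrite /radius !vec3E !exprMn -mulrDr cd mulr1.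
by rewrite sqrtr_sqr ger0_norm.
Qed.

Lemma polarP (v : V) : 0 < radius v ->
  exists c d, c ^+ 2 + d ^+ 2 = 1 /\
    v = vec3 (radius v * c) (radius v * d) (v 0 2).
Proof.
move=> r0; exists (v 0 0 / radius v), (v 0 1 / radius v); split.
  rewrite !expr_div_n -mulrDl -[X in X / _]sqr_sqrtr ?addr_ge0 ?sqr_ge0 //.
  by rewrite -/(radius v) divff // expf_neq0 // lt0r_neq0.
by rewrite !(mulrC (radius v)) !divfK ?lt0r_neq0 //; exact: vec3_surj.
Qed.

Lemma radius_near r y : (r - 2) ^+ 2 + y ^+ 2 < 2 -> 2^-1 < r :> R.
Proof. by rewrite !expr2 => h; rewrite ltNge; apply/negP => h'; nra. Qed.

(** Within distance sqrt 2 of the core the radius exceeds 1/2, so the truncation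
    of the denominator is not felt. *)
Lemma twist_polar s r c d y :
    c ^+ 2 + d ^+ 2 = 1 -> (r - 2) ^+ 2 + y ^+ 2 < 2 ->
  let a := s * (pi * clamp (2 - ((r - 2) ^+ 2 + y ^+ 2))) in
  let r' := 2 + (r - 2) * cos a - y * sin a in
  twist s (vec3 (r * c) (r * d) y) =
  vec3 (r' * c) (r' * d) ((r - 2) * sin a + y * cos a).
Proof.
move=> cd near; have r2 := radius_near near.
have r0 : 0 < r by apply: lt_trans r2; rewrite invr_gt0.
rewrite /twist /twist_angle /core_dist2 radius_polar ?ltW // !vec3E /=.
rewrite max_l ?ltW //; set a := s * _.
by congr vec3; field; rewrite lt0r_neq0.
Qed.

Lemma twist_far s v : 2 <= core_dist2 v -> twist s v = v.
Proof.
move=> far; rewrite /twist /twist_angle.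
have -> : clamp (2 - core_dist2 v) = 0.
  rewrite /clamp max_l // ge_min; apply/orP; right; lra.
rewrite !mulr0 cos0 sin0 subrr !mulr0 subrr mul0r addr0 !mulr1 add0r.
by rewrite -vec3_surj.
Qed.

(** The twist keeps the distance to the core, hence its own angle, so the twist by
    the opposite amount undoes it. *)
Lemma twistK s : cancel (twist s) (twist (- s)).
Proof.
move=> v; have [far|near] := leP 2 (core_dist2 v); first by rewrite !twist_far.
have r2 := radius_near near.
have [|c [d [cd vE]]] := @polarP v.
  by apply: lt_trans r2; rewrite invr_gt0.
rewrite vE; move: near; rewrite /core_dist2.
move: (radius v) (v 0 2) => r y near; rewrite twist_polar //=.
set q := _ ^+ 2 + _ in near *; set a := s * _.
have cs := cos2Dsin2 a.
have qE : (2 + (r - 2) * cos a - y * sin a - 2) ^+ 2 +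
          ((r - 2) * sin a + y * cos a) ^+ 2 = q.
  transitivity (q * (cos a ^+ 2 + sin a ^+ 2)); last by rewrite cs mulr1.
  by rewrite /q; ring.
rewrite twist_polar ?qE // mulNr -/a cosN sinN.
congr vec3.
- congr (_ * _).
  transitivity (2 + (r - 2) * (cos a ^+ 2 + sin a ^+ 2)); first by ring.
  by rewrite cs; ring.
- congr (_ * _).
  transitivity (2 + (r - 2) * (cos a ^+ 2 + sin a ^+ 2)); first by ring.
  by rewrite cs; ring.
- transitivity (y * (cos a ^+ 2 + sin a ^+ 2)); first by ring.
  by rewrite cs mulr1.
Qed.

Lemma twist_isotopy : isotopy twist (fun s => twist (- s)).
Proof.
split.
- exact: continuous_twist.
- apply: (continuous_substitute continuous_twist); last first.
    by move=> ?; exact: cvg_snd.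
  by apply: ctsN => ?; exact: cvg_fst.
- exact: twistK.
- by move=> s v; rewrite -{1}(opprK s) twistK.
- move=> v; rewrite /twist /twist_angle mul0r cos0 sin0 subrr !mulr0 subrr.
  by rewrite mul0r addr0 !mulr1 add0r -vec3_surj.
Qed.

Definition axial_rotation (b : R) (v : V) : V :=
  vec3 (v 0 0 * cos b - v 0 1 * sin b) (v 0 0 * sin b + v 0 1 * cos b) (v 0 2).

Lemma axial_rotationK b : cancel (axial_rotation b) (axial_rotation (- b)).
Proof.
move=> v; rewrite /axial_rotation !vec3E cosN sinN [RHS]vec3_surj.
have cs := cos2Dsin2 b; congr vec3.
- transitivity (v 0 0 * (cos b ^+ 2 + sin b ^+ 2)); first by ring.
  by rewrite cs mulr1.
- transitivity (v 0 1 * (cos b ^+ 2 + sin b ^+ 2)); first by ring.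
  by rewrite cs mulr1.
Qed.

Lemma axial_rotation_isotopy b :
  isotopy (fun s => axial_rotation (s * b))
          (fun s => axial_rotation (- (s * b))).
Proof.
have c1 : continuous (fun z : R * V => z.1 * b).
  by apply: ctsM; [move=> ?; exact: cvg_fst | exact: cts_cst].
have c2 j : continuous (fun z : R * V => z.2 0 j).
  by apply: cts_coord => ?; exact: cvg_snd.
have cr (f : R * V -> R) : continuous f ->
    continuous (fun z => axial_rotation (f z) z.2).
  move=> cf; have cc := cts_comp (@continuous_cos R) cf.
  have cs := cts_comp (@continuous_sin R) cf.
  by apply: continuous_vec3;
    do ![exact: c2 | exact: cc | exact: cs
        | apply: ctsD | apply: ctsM | apply: ctsN].
split.
- exact: cr.
- by apply: cr; exact: ctsN.
- by move=> s; exact: axial_rotationK.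
- by move=> s v; rewrite -{1}(opprK (s * b)) axial_rotationK.
- move=> v; rewrite mul0r /axial_rotation cos0 sin0 !mulr0 !mulr1.
  by rewrite subr0 add0r -vec3_surj.
Qed.
End Twist.

(** * The symmetry of the Turk's head link *)

Section TurksHead.
Variable R : realType.
Local Notation V := 'rV[R]_3.

(** The braid word, continued periodically to all natural indices; the period is 2,
    one slab for each letter. *)
Definition slab (m : nat) : geometric_braid R :=
  if odd m then braid_inv (@sigma R 3 2) else @sigma R 3 1.

(** The point of the closure over the point (x, y) of the braid at height
    tau / 2n: each slab takes an angle pi / n, and tau counts the slabs. *)
Definition screw_point (n : nat) (x y tau : R) : V :=
  let b := pi * tau / n%:R in vec3 (x * cos b) (x * sin b) y.

Lemma slice_eq (B : geometric_braid R) p t t' : t = t' -> B (p, t) -> B (p, t').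
Proof. by move=> ->. Qed.

(** The two letters of the k-th factor are the slabs 2k and 2k + 1. *)
Lemma braid_prod_A3 n x y t :
  braid_prod (nseq n (@braid_A3 R)) ((x, y), t) <->
  exists2 m, (m < n.*2)%N & slab m ((x, y), n.*2%:R * t - m%:R).
Proof.
split.
- move=> [k]; rewrite size_nseq => kn; rewrite nth_nseq kn => -[j j2] /=.
  case: j j2 => [|[|//]] _ /= h.
  + exists k.*2; rewrite ?ltn_double // /slab odd_double.
    by apply: slice_eq h; rewrite -!muln2 !natrM; ring.
  + exists k.*2.+1; rewrite ?ltn_Sdouble // /slab /= odd_double /=.
    by apply: slice_eq h; rewrite -addn1 natrD -!muln2 !natrM; ring.
- move=> [m mn h]; have kn : (m./2 < n)%N by rewrite ltn_half_double.
  exists m./2; rewrite ?size_nseq // nth_nseq kn /=.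
  exists (odd m : nat) => /=; first by case: odd.
  move: h; rewrite /slab -{2}(odd_double_half m) natrD -!muln2 !natrM.
  by case: odd => h; apply: (slice_eq _ h) => /=; ring.
Qed.

Lemma cos_add_turns (a : R) k : cos (a + 2 * pi * k%:R) = cos a.
Proof.
elim: k => [|k IH]; first by rewrite mulr0 addr0.
rewrite -[RHS]IH -[RHS]cosD2pi; congr cos.
by rewrite -addn1 natrD -mulr_natr; ring.
Qed.
Lemma sin_add_turns (a : R) k : sin (a + 2 * pi * k%:R) = sin a.
Proof.
elim: k => [|k IH]; first by rewrite mulr0 addr0.
rewrite -[RHS]IH -[RHS]sinD2pi; congr sin.
by rewrite -addn1 natrD -mulr_natr; ring.
Qed.

Lemma screw_point_turns n x y tau k : (0 < n)%N ->
  screw_point n x y (tau + (k * n.*2)%:R) = screw_point n x y tau.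
Proof.
move=> n0; have n0' : n%:R != 0 :> R by rewrite pnatr_eq0 -lt0n.
rewrite /screw_point (_ : _ / _ = pi * tau / n%:R + 2 * pi * k%:R).
  by rewrite cos_add_turns sin_add_turns.
by rewrite -muln2 !natrM; field.
Qed.

(** Letting [tau] and [m] run past the end of the braid word repeats the same points
    after a full turn; with this the shift by one slab needs no case for the last
    slab. *)
Lemma turks_head3P n (v : V) : (0 < n)%N ->
  turks_head3 n v <->
  exists x y tau m, slab m ((x, y), tau - m%:R) /\ v = screw_point n x y tau.
Proof.
move=> n0; have n0' : n%:R != 0 :> R by rewrite pnatr_eq0 -lt0n.
split.
- move=> [x [y [t [/braid_prod_A3[m _ h] ->]]]].
  exists x, y, (n.*2%:R * t), m; split => //.
  rewrite /screw_point (_ : pi * _ / _ = 2 * pi * t) //.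
  by rewrite -muln2 natrM; field.
- move=> [x [y [tau [m [h ->]]]]].
  have n2 : (0 < n.*2)%N by rewrite double_gt0.
  pose a := (m %/ n.*2)%N; pose tau' := tau - (a * n.*2)%:R.
  exists x, y, (tau' / n.*2%:R); split.
    apply/braid_prod_A3; exists (m %% n.*2)%N; first by rewrite ltn_mod.
    have -> : slab (m %% n.*2) = slab m.
      by rewrite /slab [in RHS](divn_eq m n.*2) oddD oddM odd_double andbF.
    apply: slice_eq h; rewrite /tau' {1}(divn_eq m n.*2) natrD.
    rewrite [_ * (_ / _)]mulrC divfK; first by rewrite /a; ring.
    by rewrite pnatr_eq0 -lt0n.
  rewrite -[tau](subrK (a * n.*2)%:R) screw_point_turns // -/tau'.
  rewrite /screw_point (_ : pi * _ / _ = 2 * pi * (tau' / n.*2%:R)) //.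
  by rewrite -muln2 natrM; field.
Qed.

(** The reflection x |-> 4 - x exchanges the strand positions 1, 2 and 2, 3 and
    reverses the sense of the half turns, so it turns sigma_1 into sigma_2^-1 and
    conversely.  In the formulas, reversing the time u to 1 - u changes the sign
    of the cosine only. *)
Lemma slab_flip m x y u :
  slab m ((x, y), u) -> slab m.+1 ((4 - x, y), u).
Proof.
have E : cos (pi * (1 - u)) = - cos (pi * u).
  by rewrite mulrBr mulr1 cosB cospi sinpi; ring.
have F : sin (pi * (1 - u)) = sin (pi * u).
  by rewrite mulrBr mulr1 sinB cospi sinpi; ring.
rewrite /slab /=; case: odd => /=; rewrite /braid_inv /sigma /=.
- move=> [u01 h]; split; first by lra.
  move: h; rewrite E F => -[[j [j3 j2 j3' [-> ->]]]|[-> ->]|[-> ->]].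
  + constructor 1; exists 3%N; split => //.
    move: j j3 j2 j3' => [|[|[|[|]]]] //= _ _ _.
    by congr pair; ring.
  + by constructor 2; congr pair; lra.
  + by constructor 3; congr pair; lra.
- move=> [u01 h]; split; first by lra.
  move: h; rewrite E F => -[[j [j3 j2 j3' [-> ->]]]|[-> ->]|[-> ->]].
  + constructor 1; exists 1%N; split => //.
    move: j j3 j2 j3' => [|[|[|[|]]]] //= _ _ _.
    by congr pair; ring.
  + by constructor 2; congr pair; lra.
  + by constructor 3; congr pair; lra.
Qed.

Lemma slab_bounded m x y u :
  slab m ((x, y), u) -> (x - 2) ^+ 2 + y ^+ 2 <= 1.
Proof.
rewrite /slab; case: odd; rewrite /braid_inv /sigma /= => -[_];
  set b := pi * _; have cs := cos2Dsin2 b; have := cos_le1 b;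
  have := cos_geN1 b;
  move: cs; rewrite !expr2 => cs c1 c2;
  move=> [[j [j3 j2 j3' [-> ->]]]|[-> ->]|[-> ->]];
  try (by nra);
  by move: j j3 j2 j3' => [|[|[|[|]]]] //= _ _ _; lra.
Qed.

(** On the link the twist angle is pi, so the twist is the half turn
    (x, y) |-> (4 - x, - y) of the meridian disc. *)
Lemma twist_rotation_flip n (x y tau : R) :
    (0 < n)%N -> (x - 2) ^+ 2 + y ^+ 2 <= 1 ->
  axial_rotation (1 * (pi / n%:R)) (twist 1 (screw_point n x y tau)) =
  reflection (vec3 0 0 1) 0 (screw_point n (4 - x) y (tau + 1)).
Proof.
move=> n0 h; have n0' : n%:R != 0 :> R by rewrite pnatr_eq0 -lt0n.
rewrite /screw_point twist_polar; [|exact: cos2Dsin2|];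
  last by apply: le_lt_trans h _; rewrite ltr1n.
have -> : clamp (2 - ((x - 2) ^+ 2 + y ^+ 2)) = 1.
  by rewrite /clamp min_l ?max_r //; lra.
rewrite mulr1 !mul1r cospi sinpi /axial_rotation !vec3E.
have -> : pi * (tau + 1) / n%:R = pi * tau / n%:R + pi / n%:R by field.
rewrite cosD sinD /reflection !dotvE !big_ord_recl !big_ord0 /= !mxE /=.
apply/rowP => -[[|[|[|//]]] p]; rewrite !mxE /=; by field.
Qed.

(** For the converse inclusion the screw has to be inverted on the link; its
    inverse is the flip followed by a shift of 2n - 1 slabs, as 2n slabs make a full
    turn and 2n - 1 is odd. *)
Lemma turks_head3_mirror n : (0 < n)%N ->
  isotopic (turks_head3 n) (reflection (vec3 0 0 1) 0 @` @turks_head3 R n).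
Proof.
move=> n0.
apply: (@isotopic_trans _ _ (twist 1 @` @turks_head3 R n)).
  exists (@twist R), (fun s => twist (- s)); split=> //.
  exact: twist_isotopy.
exists (fun s => axial_rotation (s * (pi / n%:R))),
  (fun s => axial_rotation (- (s * (pi / n%:R)))); split.
  exact: axial_rotation_isotopy.
rewrite image_comp; apply/seteqP; split => w [v /turks_head3P].
- move=> /(_ n0) [x [y [tau [m [h ->]]]]] <- /=.
  rewrite twist_rotation_flip //; last exact: slab_bounded h.
  exists (screw_point n (4 - x) y (tau + 1)) => //.
  apply/turks_head3P => //; exists (4 - x), y, (tau + 1), m.+1; split => //.
  apply: slice_eq (slab_flip h); rewrite -addn1 natrD; ring.
- move=> /(_ n0) [x [y [tau [m [h ->]]]]] <- /=.
  pose k := n.*2.-1; have kE : n.*2%:R = k%:R + 1 :> R.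
    by rewrite natr1 prednK // double_gt0.
  have hk : slab (m + k) ((4 - x, y), tau - m%:R).
    have -> : slab (m + k) = slab m.+1; last exact: slab_flip.
    rewrite /slab oddD /= /k -subn1 oddB ?double_gt0 // odd_double.
    by rewrite addbT.
  exists (screw_point n (4 - x) y (tau + k%:R)).
    apply/turks_head3P => //; exists (4 - x), y, (tau + k%:R), (m + k)%N.
    split => //.
    apply: slice_eq hk; rewrite natrD; ring.
  rewrite twist_rotation_flip //; last exact: slab_bounded hk.
  rewrite opprB addrCA subrr addr0 -addrA -kE -[n.*2]mul1n.
  by rewrite screw_point_turns.
Qed.
End TurksHead.

Theorem corollary4 (R : realType) (n : nat) (hn : (1 <= n)%N) :
  amphichiral (@turks_head3 R n).
Proof.
move=> u a u0; apply: isotopic_link_equiv.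
apply: isotopic_trans (turks_head3_mirror R hn) _.
apply: isotopic_reflections => //.
apply/eqP => /rowP /(_ 2); rewrite vec3_2 mxE => /eqP.
by rewrite oner_eq0.
Qed.
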